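(* Let $(\mathcal{A},[\cdot,\cdot],\omega)$ be a symplectic mock-Lie algebra and let $r=\sum r^1\otimes r^2\in\mathcal{A}\otimes\mathcal{A}$. Suppose that $(\mathcal{A},[\cdot,\cdot],r,\Delta_r)$ is a quasitriangular mock-Lie bialgebra, and that $(\mathcal{A},\Delta_r,\omega,[\cdot,\cdot]_\omega)$ is a dual quasitriangular mock-Lie bialgebra. Then $(\mathcal{A},[\cdot,\cdot],N)$ is a Nijenhuis mock-Lie algebra, where $N:\mathcal{A}\to\mathcal{A}$ is given by $$N(x)=\sum\omega(x,r^1)\,r^2,\qquad x\in\mathcal{A}.$$
   Context: All vector spaces are over a field $K$ of characteristic zero. A mock-Lie algebra $(\mathcal{A},[\cdot,\cdot])$ is a vector space with a bilinear map $[\cdot,\cdot]:\mathcal{A}\times\mathcal{A}\to\mathcal{A}$ such that $[x,y]=[y,x]$ and $[x,[y,z]]+[y,[z,x]]+[z,[x,y]]=0$ for all $x,y,z$. A Nijenhuis mock-Lie algebra $(\mathcal{A},[\cdot,\cdot],N)$ is a mock-Lie algebra with a linear map $N:\mathcal{A}\to\mathcal{A}$ such that $[N(x),N(y)]+N^2([x,y])=N([N(x),y])+N([x,N(y)])$ for all $x,y$. A mock-Lie coalgebra $(\mathcal{A},\Delta)$ is a vector space with a linear map $\Delta:\mathcal{A}\to\mathcal{A}\otimes\mathcal{A}$, $\Delta(x)=x_{(1)}\otimes x_{(2)}$ (Sweedler notation), such that $x_{(1)}\otimes x_{(2)}=x_{(2)}\otimes x_{(1)}$ and $x_{(1)}\otimes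 x_{(2)(1)}\otimes x_{(2)(2)}+x_{(1)(1)}\otimes x_{(1)(2)}\otimes x_{(2)}+x_{(2)(1)}\otimes x_{(1)}\otimes x_{(2)(2)}=0$. A mock-Lie bialgebra $(\mathcal{A},[\cdot,\cdot],\Delta)$ is a vector space that is both a mock-Lie algebra and a mock-Lie coalgebra and satisfies $\Delta([x,y])=-[x,y_{(1)}]\otimes y_{(2)}-y_{(1)}\otimes[x,y_{(2)}]-[y,x_{(1)}]\otimes x_{(2)}-x_{(1)}\otimes[y,x_{(2)}]$ for all $x,y$. A symplectic mock-Lie algebra $(\mathcal{A},[\cdot,\cdot],\omega)$ is a mock-Lie algebra with a bilinear form $\omega$ that is skew-symmetric ($\omega(x,y)=-\omega(y,x)$) and satisfies $\omega([x,y],z)+\omega([y,z],x)+\omega([z,x],y)=0$ for all $x,y,z$ (nondegeneracy is not required). For $r=\sum r^1\otimes r^2\in\mathcal{A}\otimes\mathcal{A}$ (with $\bar r$ another copy of $r$), $\Delta_r(x)=\sum[x,r^1]\otimes r^2-r^1\otimes[x,r^2]$. The quadruple $(\mathcal{A},[\cdot,\cdot],r,\Delta_r)$ is called a quasitriangular mock-Lie bialgebra if $r$ is antisymmetric ($r=-\tau(r)$, $\tau$ the flip) and satisfies $\sum[r^1,\bar r^1]\otimes r^2\otimes\bar r^2+r^1\otimes\bar r^1\otimes[r^2,\bar r^2]-r^1\otimes[\bar r^1,r^2]\otimes\bar r^2=0$ (in this case $(\mathcal{A},[\cdot,\cdot],\Delta_r)$ is a mock-Lie bialgebra). For a mock-Lie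 coalgebra $(\mathcal{A},\Delta)$ and a bilinear form $\omega$ on $\mathcal{A}$, put $[x,y]_\omega=x_{(1)}\omega(x_{(2)},y)-y_{(1)}\omega(x,y_{(2)})$. The quadruple $(\mathcal{A},\Delta,\omega,[\cdot,\cdot]_\omega)$ is called a dual quasitriangular mock-Lie bialgebra if $\omega$ is skew-symmetric and $\omega(x_{(1)},y)\omega(x_{(2)},z)+\omega(x,z_{(1)})\omega(y,z_{(2)})-\omega(x,y_{(1)})\omega(y_{(2)},z)=0$ for all $x,y,z$ (in this case $(\mathcal{A},[\cdot,\cdot]_\omega,\Delta)$ is a mock-Lie bialgebra). *)

(* Defs.v *)
From HB Require Import structures.
From mathcomp Require Import all_boot all_algebra.
From mathcomp Require Import boolp freeg.

Set Implicit Arguments.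
Unset Strict Implicit.
Unset Printing Implicit Defensive.

Import GRing.Theory.
Import Quotient.Exports.

Local Open Scope ring_scope.
Local Open Scope quotient_scope.

Reserved Notation "A ⊗ B" (at level 40, left associativity).
Reserved Notation "a '\ox' b" (at level 40, left associativity).
Reserved Notation "'\tsum_' ( a '\ox' b <- t ) F"
  (at level 41, F at level 41, a name, b name, t at level 69,
   format "'\tsum_' ( a  '\ox'  b  <-  t )  F").

(* A ⊗ B is the quotient of the free vector space on A * B by the subspace
   spanned by the bilinearity relations. *)
Section TensorProduct.
Variables (K : fieldType) (A B : lmodType K).

Local Notation free := {freeg (A * B)%type / K}.
Local Notation gen a b := (<< (a, b) >> : free).

Inductive tensor_null : free -> Prop :=
| null_addl a1 a2 b :
    tensor_null (gen (a1 + a2) b - (gen a1 b + gen a2 b))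
| null_addr a b1 b2 :
    tensor_null (gen a (b1 + b2) - (gen a b1 + gen a b2))
| null_scalel k a b : tensor_null (gen (k *: a) b - k *: gen a b)
| null_scaler k a b : tensor_null (gen a (k *: b) - k *: gen a b)
| null_zero : tensor_null 0
| null_lincomb k u v :
    tensor_null u -> tensor_null v -> tensor_null (k *: u + v).

Definition tensor_nullb : {pred free} := fun u => `[< tensor_null u >].

Lemma tensor_nullP u : reflect (tensor_null u) (u \in tensor_nullb).
Proof. exact: asboolP. Qed.

Lemma tensor_null_zmod_closed : zmod_closed tensor_nullb.
Proof.
split=> [|u v /tensor_nullP nu /tensor_nullP nv]; apply/tensor_nullP.
  exact: null_zero.
by rewrite -scaleN1r addrC; apply: null_lincomb.
Qed.

HB.instance Definition _ :=
  GRing.isZmodClosed.Build free tensor_nullb tensor_null_zmod_closed.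

Definition tensor := Quotient.quot tensor_nullb.

HB.instance Definition _ := GRing.Zmodule.on tensor.
HB.instance Definition _ := EqQuotient.on tensor.

Lemma pi_tensorD : {morph \pi_tensor : u v / u + v}.
Proof. by move=> u v; rewrite !piE. Qed.

Lemma pi_tensorN : {morph \pi_tensor : u / - u}.
Proof. by move=> u; rewrite !piE. Qed.

Lemma pi_tensor0 : \pi_tensor 0 = 0.
Proof. by rewrite -[X in \pi X](subrr 0) pi_tensorD pi_tensorN subrr. Qed.

Lemma pi_tensor_eqP u v :
  reflect (\pi_tensor u = \pi_tensor v) (u - v \in tensor_nullb).
Proof. by rewrite Quotient.idealrBE; apply: eqP. Qed.

Lemma tensor_null_scale k u : tensor_null u -> tensor_null (k *: u).
Proof. by move=> nu; rewrite -[_ *: _]addr0; apply: null_lincomb null_zero. Qed.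

Definition tensor_scale (k : K) (t : tensor) : tensor :=
  \pi_tensor (k *: repr t).

Lemma tensor_scale_pi k u :
  tensor_scale k (\pi_tensor u) = \pi_tensor (k *: u).
Proof.
apply/pi_tensor_eqP; rewrite -scalerBr; apply/tensor_nullP.
apply: tensor_null_scale; apply/tensor_nullP.
by apply/pi_tensor_eqP; rewrite reprK.
Qed.

Lemma tensor_scaleA k l t :
  tensor_scale k (tensor_scale l t) = tensor_scale (k * l) t.
Proof. by rewrite -[t]reprK (tensor_scale_pi l) !tensor_scale_pi scalerA. Qed.

Lemma tensor_scale1 : left_id 1 tensor_scale.
Proof. by move=> t; rewrite -[t]reprK tensor_scale_pi scale1r. Qed.

Lemma tensor_scaleDr : right_distributive tensor_scale +%R.
Proof.
move=> k s t; rewrite -[s]reprK -[t]reprK.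
by rewrite -pi_tensorD !tensor_scale_pi -pi_tensorD scalerDr.
Qed.

Lemma tensor_scaleDl t : {morph tensor_scale^~ t : k l / k + l}.
Proof.
move=> k l; rewrite -[t]reprK /=.
by rewrite !tensor_scale_pi -pi_tensorD scalerDl.
Qed.

HB.instance Definition _ := GRing.Zmodule_isLmodule.Build K tensor
  tensor_scaleA tensor_scale1 tensor_scaleDr tensor_scaleDl.

Lemma pi_tensorZ k u : \pi_tensor (k *: u) = k *: (\pi_tensor u) :> tensor.
Proof. by rewrite -tensor_scale_pi. Qed.

Definition tpure (a : A) (b : B) : tensor := \pi_tensor (gen a b).

Lemma tpureDl b : {morph tpure^~ b : a1 a2 / a1 + a2}.
Proof.
move=> a1 a2; rewrite /= /tpure -pi_tensorD.
by apply/pi_tensor_eqP/tensor_nullP; apply: null_addl.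
Qed.

Lemma tpureDr a : {morph tpure a : b1 b2 / b1 + b2}.
Proof.
move=> b1 b2; rewrite /tpure -pi_tensorD.
by apply/pi_tensor_eqP/tensor_nullP; apply: null_addr.
Qed.

Lemma tpureZl k a b : tpure (k *: a) b = k *: tpure a b.
Proof.
by rewrite /tpure -pi_tensorZ; apply/pi_tensor_eqP/tensor_nullP; apply: null_scalel.
Qed.

Lemma tpureZr k a b : tpure a (k *: b) = k *: tpure a b.
Proof.
by rewrite /tpure -pi_tensorZ; apply/pi_tensor_eqP/tensor_nullP; apply: null_scaler.
Qed.

Lemma tpure_bilinear : bilinear_for *:%R *:%R tpure.
Proof.
split=> [b k a1 a2|a k b1 b2] /=.
  by rewrite tpureDl tpureZl.
by rewrite tpureDr tpureZr.
Qed.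

HB.instance Definition _ :=
  bilinear_isBilinear.Build K A B tensor *:%R *:%R tpure tpure_bilinear.

Lemma tensor_ind (P : tensor -> Prop) :
  P 0 -> (forall k a b t, P t -> P (k *: tpure a b + t)) -> forall t, P t.
Proof.
move=> P0 PD t; rewrite -[t]reprK -[repr t]freeg_sumE.
elim: (dom _) => [|[a b] s IHs]; first by rewrite big_nil pi_tensor0.
rewrite big_cons pi_tensorD.
suff -> : << coeff (a, b) (repr t) *g (a, b) >>
        = coeff (a, b) (repr t) *: gen a b by rewrite pi_tensorZ; apply: PD.
by apply/eqP/freeg_eqP => x; rewrite coeffZ !coeffU mul1r.
Qed.

(* Sweedler summation: writing t as a finite sum of pure tensors a \ox b, the
   sum of the F a b.  The decomposition used is the one of a chosen
   representative of t, so this only depends on t (and is the map induced on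
   A ⊗ B by the universal property) when F is bilinear, see tsum_tpure and
   tsum_linear; it must not be used with an F that is not bilinear. *)
Definition tsum (V : lmodType K) (F : A -> B -> V) (t : tensor) : V :=
  \sum_(p <- dom (repr t)) coeff p (repr t) *: F p.1 p.2.

Section UniversalProperty.
Variables (V : lmodType K) (F : A -> B -> V).

Let lift : free -> V := fglift (fun p => F p.1 p.2).

Let liftB : {morph lift : u v / u - v}.
Proof. exact: lift_is_additive. Qed.

Let lift_0 : lift 0 = 0.
Proof. by rewrite -(subrr 0) liftB subrr. Qed.

Let liftD : {morph lift : u v / u + v}.
Proof. by move=> u v; rewrite -{1}[v]opprK -[- v]add0r !liftB lift_0 sub0r !opprK. Qed.

Let lift_gen k p : lift << k *g p >> = k *: F p.1 p.2.
Proof. exact: liftU. Qed.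

Let tsum_lift t : tsum F t = lift (repr t).
Proof.
rewrite -[in RHS](freeg_sumE (repr t)) (big_morph lift liftD lift_0).
by apply: eq_bigr => p _; rewrite lift_gen.
Qed.

Let liftZ k : {morph lift : u / k *: u}.
Proof.
have liftE v : lift v = \sum_(p <- dom v) coeff p v *: F p.1 p.2.
  rewrite -{1}(freeg_sumE v) (big_morph lift liftD lift_0).
  by apply: eq_bigr => p _; rewrite lift_gen.
move=> u; rewrite [k *: u]/(fgscale k u) (big_morph lift liftD lift_0).
rewrite liftE scaler_sumr.
by apply: eq_bigr => p _; rewrite lift_gen scalerA.
Qed.

Hypothesis Fbilin : bilinear_for *:%R *:%R F.

Let lift_null u : tensor_null u -> lift u = 0.
Proof.
have FDl a1 a2 b : F (a1 + a2) b = F a1 b + F a2 b.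
  by have := Fbilin.1 b 1 a1 a2; rewrite /= !scale1r.
have FDr a b1 b2 : F a (b1 + b2) = F a b1 + F a b2.
  by have := Fbilin.2 a 1 b1 b2; rewrite /= !scale1r.
have F0l b : F 0 b = 0 by apply: (addrI (F 0 b)); rewrite -FDl !addr0.
have F0r a : F a 0 = 0 by apply: (addrI (F a 0)); rewrite -FDr !addr0.
have FZl k a b : F (k *: a) b = k *: F a b.
  by have := Fbilin.1 b k a 0; rewrite /= F0l !addr0.
have FZr k a b : F a (k *: b) = k *: F a b.
  by have := Fbilin.2 a k b 0; rewrite /= F0r !addr0.
elim=> [a1 a2 b|a b1 b2|k a b|k a b||k v w _ lv _ lw].
- by rewrite liftB liftD !lift_gen !scale1r FDl subrr.
- by rewrite liftB liftD !lift_gen !scale1r FDr subrr.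
- by rewrite liftB liftZ !lift_gen !scale1r FZl subrr.
- by rewrite liftB liftZ !lift_gen !scale1r FZr subrr.
- exact: lift_0.
- by rewrite liftD liftZ lv lw scaler0 addr0.
Qed.

Let tsum_pi u : tsum F (\pi_tensor u) = lift u.
Proof.
apply/eqP; rewrite tsum_lift -subr_eq0 -liftB; apply/eqP/lift_null.
by apply/tensor_nullP/pi_tensor_eqP; rewrite reprK.
Qed.

Lemma tsum_tpure a b : tsum F (tpure a b) = F a b.
Proof. by rewrite tsum_pi lift_gen scale1r. Qed.

Lemma tsum_linear : linear (tsum F).
Proof.
move=> k s t; rewrite -[s]reprK -[t]reprK -pi_tensorZ -pi_tensorD !tsum_pi.
by rewrite liftD liftZ.
Qed.

End UniversalProperty.

Lemma tsum_fun_linear (V : lmodType K) (F G : A -> B -> V) k t :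
  tsum (fun a b => k *: F a b + G a b) t = k *: tsum F t + tsum G t.
Proof.
rewrite /tsum scaler_sumr -big_split; apply: eq_bigr => p _ /=.
by rewrite scalerDr !scalerA [k * _]mulrC.
Qed.

End TensorProduct.

Arguments tensor {K} A B.
Arguments tpure {K A B} a b.
Arguments tsum {K A B V} F t.

Notation "A ⊗ B" := (tensor A B) : type_scope.
Notation "a \ox b" := (tpure a b) : ring_scope.
Notation "'\tsum_' ( a '\ox' b <- t ) F" := (tsum (fun a b => F) t) : ring_scope.

Section MockLie.
Variables (K : fieldType) (A : lmodType K).

Definition flip (t : A ⊗ A) : A ⊗ A := \tsum_(a \ox b <- t) (b \ox a).

(* A ⊗ A ⊗ A is bracketed to the right: a \ox (b \ox c) : A ⊗ (A ⊗ A). *)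

Record mock_lie_algebra (br : {bilinear A -> A -> A}) : Prop := {
  mock_lie_comm : forall x y, br x y = br y x;
  mock_lie_jacobi : forall x y z,
    br x (br y z) + br y (br z x) + br z (br x y) = 0
}.

Record nijenhuis_mock_lie_algebra
    (br : {bilinear A -> A -> A}) (N : {linear A -> A}) : Prop := {
  nijenhuis_mock_lie : mock_lie_algebra br;
  nijenhuis_identity : forall x y,
    br (N x) (N y) + N (N (br x y)) = N (br (N x) y) + N (br x (N y))
}.

Record mock_lie_coalgebra (D : {linear A -> A ⊗ A}) : Prop := {
  mock_lie_cocomm : forall x,
    \tsum_(x1 \ox x2 <- D x) (x1 \ox x2) =
    \tsum_(x1 \ox x2 <- D x) (x2 \ox x1);
  mock_lie_cojacobi : forall x,
    \tsum_(x1 \ox x2 <- D x) \tsum_(x21 \ox x22 <- D x2)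
       (x1 \ox (x21 \ox x22))
    + \tsum_(x1 \ox x2 <- D x) \tsum_(x11 \ox x12 <- D x1)
       (x11 \ox (x12 \ox x2))
    + \tsum_(x1 \ox x2 <- D x) \tsum_(x21 \ox x22 <- D x2)
       (x21 \ox (x1 \ox x22)) = 0
}.

(* The form need not be nondegenerate. *)
Record symplectic_mock_lie_algebra
    (br : {bilinear A -> A -> A}) (w : {biscalar A}) : Prop := {
  symplectic_mock_lie : mock_lie_algebra br;
  symplectic_skew : forall x y, w x y = - w y x;
  symplectic_cocycle : forall x y z,
    w (br x y) z + w (br y z) x + w (br z x) y = 0
}.

Definition cobracket (br : {bilinear A -> A -> A}) (r : A ⊗ A) (x : A) :
    A ⊗ A :=
  \tsum_(r1 \ox r2 <- r) (br x r1 \ox r2 - r1 \ox br x r2).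

Lemma cobracket_linear br r : linear (cobracket br r).
Proof.
move=> k x y; rewrite /cobracket -tsum_fun_linear; congr tsum.
apply/funext => a; apply/funext => b.
rewrite !linearPl !linearPr scalerBr opprD.
by rewrite -!addrA; congr (_ + _); rewrite addrCA.
Qed.

HB.instance Definition _ br r :=
  GRing.isLinear.Build K A (A ⊗ A) *:%R (cobracket br r)
    (cobracket_linear br r).

Record quasitriangular_mock_lie_bialgebra
    (br : {bilinear A -> A -> A}) (r : A ⊗ A) (D : {linear A -> A ⊗ A}) :
    Prop := {
  quasitriangular_mock_lie : mock_lie_algebra br;
  quasitriangular_cobracket : D =1 cobracket br r;
  quasitriangular_antisym : r = - flip r;
  quasitriangular_eq :
    \tsum_(r1 \ox r2 <- r) \tsum_(s1 \ox s2 <- r)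
      (br r1 s1 \ox (r2 \ox s2) + r1 \ox (s1 \ox br r2 s2)
       - r1 \ox (br s1 r2 \ox s2)) = 0
}.

Definition form_bracket (D : {linear A -> A ⊗ A}) (w : {biscalar A})
    (x y : A) : A :=
  \tsum_(x1 \ox x2 <- D x) (w x2 y *: x1)
  - \tsum_(y1 \ox y2 <- D y) (w x y2 *: y1).

Lemma form_bracket_bilinear D w : bilinear_for *:%R *:%R (form_bracket D w).
Proof.
split=> [y k x x'|x k y y'] /=; rewrite /form_bracket.
  rewrite (_ : (fun y1 y2 => w (k *: x + x') y2 *: y1) =
      fun y1 y2 => k *: (w x y2 *: y1) + w x' y2 *: y1); last first.
    apply/funext => a; apply/funext => b.
    by rewrite linearPl /= scalerDl scalerA.
  rewrite tsum_fun_linear linearP tsum_linear; last first.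
    split=> [u l a b|a l u v] /=; first by rewrite scalerDr !scalerA mulrC.
    by rewrite linearPl /= scalerDl scalerA.
  by rewrite scalerBr opprD addrACA.
rewrite (_ : (fun x1 x2 => w x2 (k *: y + y') *: x1) =
    fun x1 x2 => k *: (w x2 y *: x1) + w x2 y' *: x1); last first.
  apply/funext => a; apply/funext => b.
  by rewrite linearPr /= scalerDl scalerA.
rewrite tsum_fun_linear linearP tsum_linear; last first.
  split=> [u l a b|a l u v] /=; first by rewrite scalerDr !scalerA mulrC.
  by rewrite linearPr /= scalerDl scalerA.
by rewrite scalerBr opprD addrACA.
Qed.

HB.instance Definition _ D w :=
  bilinear_isBilinear.Build K A A A *:%R *:%R (form_bracket D w)
    (form_bracket_bilinear D w).

Record dual_quasitriangular_mock_lie_bialgebra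
    (D : {linear A -> A ⊗ A}) (w : {biscalar A})
    (br : {bilinear A -> A -> A}) : Prop := {
  dual_quasitriangular_mock_lie : mock_lie_coalgebra D;
  dual_quasitriangular_bracket : br =2 form_bracket D w;
  dual_quasitriangular_skew : forall x y, w x y = - w y x;
  dual_quasitriangular_eq : forall x y z,
    \tsum_(x1 \ox x2 <- D x) (w x1 y * w x2 z : K^o)
    + \tsum_(z1 \ox z2 <- D z) (w x z1 * w y z2 : K^o)
    - \tsum_(y1 \ox y2 <- D y) (w x y1 * w y2 z : K^o) = 0
}.

Definition nijenhuis_of (w : {biscalar A}) (r : A ⊗ A) (x : A) : A :=
  \tsum_(r1 \ox r2 <- r) (w x r1 *: r2).

Lemma nijenhuis_of_linear w r : linear (nijenhuis_of w r).
Proof.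
move=> k x y; rewrite /nijenhuis_of -tsum_fun_linear; congr tsum.
apply/funext => a; apply/funext => b.
by rewrite linearPl /= scalerDl scalerA.
Qed.

HB.instance Definition _ w r :=
  GRing.isLinear.Build K A A *:%R (nijenhuis_of w r)
    (nijenhuis_of_linear w r).

End MockLie.

(* Main.v *)
Require Import Defs.
From mathcomp Require Import all_boot all_algebra.
From mathcomp Require Import ring.

Set Implicit Arguments.
Unset Strict Implicit.
Unset Printing Implicit Defensive.

Import GRing.Theory.
Local Open Scope ring_scope.

(** For $x$ fixed, $N(x)$ is the contraction of $r$ with $\omega(x,-)$ in its first
factor; since $r$ is antisymmetric, contracting with $\omega(x,-)$ in the
second factor gives $-N(x)$.  Hence every hypothesis on $r$ becomes one on $N$
once each tensor factor but one is paired with the form.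

Pairing the first two factors of the Yang-Baxter equation with $\omega(x,-)$
and $\omega(y,-)$ expresses the bracket of the images as
$$[Nx,Ny]=\sum_r \big(\omega(x,[Ny,r^1])+\omega(y,[Nx,r^1])\big)\,r^2$$
([bracket_nijenhuis_of]).  The other three terms of the Nijenhuis identity are
by definition also sums of the form $\sum_r f(r^1)\,r^2$, with $f$ equal to
$\omega(N[x,y],-)$, $\omega([Nx,y],-)$ and $\omega([x,Ny],-)$, so it is enough to
compare the functionals $f$.

The dual equation for the cobracket of $r$, rewritten in terms of $N$, is a
sum of six values $\omega([u,Nv],t)$; the cocycle condition groups them in pairs
and leaves
$$\omega([x,y],Nz)+\omega([x,z],Ny)+\omega([y,z],Nx)=0$$
([nijenhuis_of_cocycle]).  As $N$ is self-adjoint for $\omega$, because both the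
form and $r$ are antisymmetric ([nijenhuis_of_selfadjoint]), the first term is
$\omega(N[x,y],z)$.  Two more uses of the cocycle condition turn this relation
into the required equality of functionals. *)

Section SweedlerSums.
Variables (K : fieldType) (A B : lmodType K).

Lemma eq_tsum (V : lmodType K) (F G : A -> B -> V) t :
  (forall a b, F a b = G a b) -> tsum F t = tsum G t.
Proof. by move=> FG; apply: eq_bigr => p _; rewrite FG. Qed.

(** A Sweedler sum is a fixed linear combination of values of its summand, so
linear maps pass through it even when the summand is not bilinear. *)
Lemma linear_tsum (V W : lmodType K) (g : V -> W) (F : A -> B -> V) t :
  linear g -> g (tsum F t) = tsum (fun a b => g (F a b)) t.
Proof.
move=> glin; have gZ := GRing.scalable_linear glin.
have g0 : g 0 = 0 by have := gZ 0 0; rewrite /= !scale0r.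
have gD : {morph g : u v / u + v}.
  by move=> u v; rewrite -[u]scale1r glin !scale1r.
by rewrite /tsum (big_morph g gD g0); apply: eq_bigr => p _; apply: gZ.
Qed.

Lemma tsumD (V : lmodType K) (F G : A -> B -> V) t :
  tsum (fun a b => F a b + G a b) t = tsum F t + tsum G t.
Proof. by rewrite /tsum -big_split; apply: eq_bigr => p _; rewrite scalerDr. Qed.

Lemma tsumN (V : lmodType K) (F : A -> B -> V) t :
  tsum (fun a b => - F a b) t = - tsum F t.
Proof. by rewrite /tsum -sumrN; apply: eq_bigr => p _; rewrite scalerN. Qed.

Lemma tsumZ (V : lmodType K) k (F : A -> B -> V) t :
  tsum (fun a b => k *: F a b) t = k *: tsum F t.
Proof.
by rewrite /tsum scaler_sumr; apply: eq_bigr => p _; rewrite !scalerA mulrC.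
Qed.

End SweedlerSums.

Lemma tsum_antisym (K : fieldType) (A V : lmodType K) (r : A ⊗ A)
    (F : A -> A -> V) :
  r = - flip r -> bilinear_for *:%R *:%R F ->
  tsum F r = - \tsum_(a \ox b <- r) F b a.
Proof.
move=> ranti Fbil; have Flin := tsum_linear Fbil.
have -> : \tsum_(a \ox b <- r) F b a = tsum F (flip r).
  by rewrite linear_tsum //; apply: eq_tsum => a b; rewrite tsum_tpure.
by rewrite {1}ranti -[- flip r]scaleN1r (GRing.scalable_linear Flin) /= scaleN1r.
Qed.

Section NijenhuisOfForm.
Variables (K : fieldType) (A : lmodType K).
Variables (br : {bilinear A -> A -> A}) (w : {biscalar A}) (r : A ⊗ A).

Local Notation N := (nijenhuis_of w r).

Lemma tsum_form_l (V : lmodType K) (g : A -> V) x :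
  linear g -> \tsum_(a \ox b <- r) (w x a *: g b) = g (N x).
Proof.
move=> glin; rewrite /nijenhuis_of linear_tsum //; apply: eq_tsum => a b.
by rewrite (GRing.scalable_linear glin).
Qed.

Hypothesis r_antisym : r = - flip r.

(** The sign comes from exchanging the two factors of the antisymmetric $r$. *)
Lemma tsum_form_r (V : lmodType K) (g : A -> V) x :
  linear g -> \tsum_(a \ox b <- r) (w x b *: g a) = - g (N x).
Proof.
move=> glin; rewrite -tsum_form_l //.
apply: tsum_antisym => //; split=> [b k a a'|a k b b'] /=.
  by rewrite glin scalerDr !scalerA mulrC.
by rewrite linearPr /= scalerDl scalerA.
Qed.

Lemma form_linear_r x : linear (fun u => w x u : K^o).
Proof. by move=> k u v; rewrite linearPr. Qed.

Lemma form_linear_l x : linear (fun u => w u x : K^o).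
Proof. by move=> k u v; rewrite linearPl. Qed.

Lemma form_bracket_linear x y : linear (fun u => w x (br y u) : K^o).
Proof. by move=> k u v; rewrite !linearPr. Qed.

Hypothesis w_skew : forall x y, w x y = - w y x.

(** Moving $N$ across the form exchanges both the two factors of $r$ and the two
arguments of the form; the two resulting signs cancel. *)
Lemma nijenhuis_of_selfadjoint x y : w (N x) y = w x (N y).
Proof.
have eN := @tsum_form_l K^o (fun u => w u y) x (form_linear_l y).
have eN' := @tsum_form_r K^o (fun u => w x u) y (form_linear_r x).
suff opp : - (w (N x) y : K^o) = - (w x (N y) : K^o) by have := oppr_inj opp.
rewrite -eN -eN' -tsumN; apply: eq_tsum => a b.
by rewrite [w b y]w_skew scalerN opprK; apply: mulrC.
Qed.

(** Pairing the cobracket with two functionals of the form: this rewrites each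
sum of the dual equation in terms of $N$. *)
Lemma tsum_cobracket_form x y z :
  \tsum_(a \ox b <- cobracket br r x) (w y a * w z b : K^o) =
  - (w y (br x (N z)) + w z (br x (N y))).
Proof.
have Fbil : bilinear_for *:%R *:%R (fun a b => w y a * w z b : K^o).
  split=> [b k a a'|a k b b'] /=.
    by rewrite linearPr /= mulrDl -mulrA.
  by rewrite linearPr /= mulrDr mulrCA.
have Flin := tsum_linear Fbil.
have eN := tsum_form_l y (form_bracket_linear z x).
have eN' := tsum_form_r z (form_bracket_linear y x).
rewrite (_ : - _ = - w y (br x (N z)) - w z (br x (N y))) ?opprD //.
rewrite -[RHS]/(- (w y (br x (N z)) : K^o) - (w z (br x (N y)) : K^o)).
rewrite -eN -eN' -tsumN -tsumD /cobracket linear_tsum //.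
apply: eq_tsum => a b; rewrite (zmod_morphism_linear Flin) !tsum_tpure //=.
by congr (_ - _); rewrite mulrC.
Qed.

Hypothesis br_comm : forall x y, br x y = br y x.
Hypothesis w_cocycle : forall x y z,
  w (br x y) z + w (br y z) x + w (br z x) y = 0.

Hypothesis w_dual : forall x y z,
  \tsum_(x1 \ox x2 <- cobracket br r x) (w x1 y * w x2 z : K^o)
  + \tsum_(z1 \ox z2 <- cobracket br r z) (w x z1 * w y z2 : K^o)
  - \tsum_(y1 \ox y2 <- cobracket br r y) (w x y1 * w y2 z : K^o) = 0.

(** The dual equation says that the six terms $\omega(t,[u,Nv])$, with $(t,u,v)$ running
over the orderings of $(x,y,z)$, add up to zero.  The cocycle condition at
$(u,t,Nv)$ turns each pair sharing the same $v$ into $\omega([u,t],Nv)$. *)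
Lemma nijenhuis_of_cocycle x y z :
  w (br x y) (N z) + w (br x z) (N y) + w (br y z) (N x) = 0.
Proof.
have e1 : \tsum_(a \ox b <- cobracket br r x) (w a y * w b z : K^o) =
    \tsum_(a \ox b <- cobracket br r x) (w y a * w z b : K^o).
  by apply: eq_tsum => a b; rewrite (w_skew a) (w_skew b) mulrNN.
have e2 : \tsum_(a \ox b <- cobracket br r y) (w x a * w b z : K^o) =
    - \tsum_(a \ox b <- cobracket br r y) (w x a * w z b : K^o).
  by rewrite -tsumN; apply: eq_tsum => a b; rewrite (w_skew b) mulrN.
move: (w_dual x y z); rewrite e1 e2 !tsum_cobracket_form !opprK => dual.
have := w_cocycle x y (N z); have := w_cocycle x z (N y).
have := w_cocycle y z (N x).
rewrite !(br_comm (N _)) ![w (br _ (N _)) _]w_skew.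
move=> cx cy cz.
transitivity (0 + 0 + 0 - 0 : K); last by rewrite subr0 !addr0.
rewrite -{1}cx -{1}cy -{1}cz -{1}dual.
ring.
Qed.

Definition contract_ad (z y : A) : A :=
  \tsum_(a \ox b <- r) (w y (br z a) *: b).

Lemma contract_ad_linear y : linear (contract_ad^~ y).
Proof.
move=> k z z' /=; rewrite /contract_ad -tsum_fun_linear.
by apply: eq_tsum => a b; rewrite linearPl linearPr scalerDl scalerA.
Qed.

(** Since [nijenhuis_of w u y] is the contraction of $u$ with $\omega(y,-)$ in its first
factor, this is the linear map
$a\otimes b\otimes c\mapsto\omega(x,a)\,\omega(y,b)\,c$. *)
Definition form_contract (x y : A) (t : A ⊗ (A ⊗ A)) : A :=
  \tsum_(a \ox u <- t) (w x a *: nijenhuis_of w u y).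

Lemma nijenhuis_of_linear_tensor y : linear (fun u => nijenhuis_of w u y).
Proof.
apply: tsum_linear; split=> [b k a a'|a k b b'] /=.
  by rewrite linearPr /= scalerDl scalerA.
by rewrite scalerDr !scalerA mulrC.
Qed.

Lemma form_contract_bilinear x y :
  bilinear_for *:%R *:%R (fun a u => w x a *: nijenhuis_of w u y).
Proof.
split=> [u k a a'|a k u u'] /=.
  by rewrite linearPr /= scalerDl scalerA.
by rewrite nijenhuis_of_linear_tensor scalerDr !scalerA mulrC.
Qed.

Lemma form_contract_linear x y : linear (form_contract x y).
Proof. exact: tsum_linear (form_contract_bilinear x y). Qed.

Lemma form_contract_tpure x y a b c :
  form_contract x y (a \ox (b \ox c)) = w x a *: (w y b *: c).
Proof.
rewrite /form_contract tsum_tpure; last exact: form_contract_bilinear.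
rewrite /nijenhuis_of tsum_tpure //; split=> [b' k u u'|u k b' b''] /=.
  by rewrite linearPr /= scalerDl scalerA.
by rewrite scalerDr !scalerA mulrC.
Qed.

Hypothesis yang_baxter :
  \tsum_(r1 \ox r2 <- r) \tsum_(s1 \ox s2 <- r)
    (br r1 s1 \ox (r2 \ox s2) + r1 \ox (s1 \ox br r2 s2)
     - r1 \ox (br s1 r2 \ox s2)) = 0.

(** The Yang-Baxter equation with its first two factors paired with $\omega(x,-)$ and
$\omega(y,-)$.  In the first term, pairing with $\omega(y,r^2)$ replaces the $r^1$ inside
the bracket by $-Ny$; this sign moves that term to the other side. *)
Lemma bracket_nijenhuis_of x y :
  br (N x) (N y) = contract_ad (N y) x + contract_ad (N x) y.
Proof.
have clin := form_contract_linear x y.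
have c0 : form_contract x y 0 = 0.
  by have := GRing.scalable_linear clin 0 0; rewrite /= !scale0r.
have cD u v :
    form_contract x y (u + v) = form_contract x y u + form_contract x y v.
  by rewrite -[u]scale1r clin !scale1r.
have := congr1 (form_contract x y) yang_baxter.
(* The inner sum over the second copy of r, for a fixed term of the first. *)
rewrite c0 linear_tsum // (@eq_tsum _ _ _ _ _ (fun r1 r2 =>
    w y r2 *: contract_ad r1 x + w x r1 *: br r2 (N y)
    - w x r1 *: contract_ad r2 y)); last first.
  move=> r1 r2; rewrite linear_tsum //.
  rewrite -tsum_form_l; last by move=> k u v; rewrite linearPr.
  rewrite /contract_ad -!tsumZ -tsumN -!tsumD; apply: eq_tsum => s1 s2.
  rewrite (zmod_morphism_linear clin) cD !form_contract_tpure (br_comm s1).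
  by congr (_ + _ - _); rewrite !scalerA mulrC.
rewrite !tsumD tsumN tsum_form_r; last exact: contract_ad_linear.
rewrite !tsum_form_l; [|exact: contract_ad_linear|]; last first.
  by move=> k u v; rewrite linearPl.
by move/eqP; rewrite subr_eq0 addrC subr_eq addrC => /eqP.
Qed.

Lemma nijenhuis_of_identity x y :
  br (N x) (N y) + N (N (br x y)) = N (br (N x) y) + N (br x (N y)).
Proof.
have NE u : N u = \tsum_(a \ox b <- r) (w u a *: b) by [].
rewrite bracket_nijenhuis_of /contract_ad (NE (N _)).
rewrite (NE (br (N x) y)) (NE (br x (N y))) -!tsumD; apply: eq_tsum => a b.
rewrite -!scalerDl nijenhuis_of_selfadjoint; congr (_ *: _).
have dual := nijenhuis_of_cocycle x y a.
have := w_cocycle y (N x) a; have := w_cocycle x (N y) a.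
rewrite (br_comm a x) (br_comm a y) (br_comm y (N x)).
rewrite (w_skew (br (N y) a)) (w_skew (br (N x) a)) => cy cx.
transitivity (w (br (N x) y) a + w (br x (N y)) a - 0 - 0 + 0 : K).
  by rewrite -{1}cx -{1}cy -{1}dual; ring.
by rewrite !subr0 addr0.
Qed.

End NijenhuisOfForm.

Theorem theorem2p22 (K : fieldType) (charK0 : [pchar K] =i pred0)
    (A : lmodType K) (br : {bilinear A -> A -> A}) (w : {biscalar A})
    (r : A ⊗ A) :
  symplectic_mock_lie_algebra br w ->
  quasitriangular_mock_lie_bialgebra br r (cobracket br r) ->
  dual_quasitriangular_mock_lie_bialgebra
    (cobracket br r) w (form_bracket (cobracket br r) w) ->
  nijenhuis_mock_lie_algebra br (nijenhuis_of w r).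
Proof.
move=> [mockLie skew cocycle] [_ _ antisym yb] [_ _ _ dual].
split=> // x y; apply: nijenhuis_of_identity => //.
exact: mock_lie_comm mockLie.
Qed.
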